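(* Let $N$ be a complex 2-step nilpotent Lie group equipped with a left invariant Hermitian metric $g$. Then $(N,g)$ admits a non-parallel invertible Killing-Yano tensor.
   Context: A Lie group $N$ is called 2-step nilpotent if its Lie algebra $\mathfrak{n}$ is not abelian and satisfies $[[\mathfrak{n},\mathfrak{n}],\mathfrak{n}]=0$. A complex Lie group $N$ carries a bi-invariant complex structure $J$; on the (real) Lie algebra $\mathfrak{n}$ it is given by a linear map $J:\mathfrak{n}\to\mathfrak{n}$ with $J^2=-\mathrm{Id}$ and $J[x,y]=[Jx,y]=[x,Jy]$ for all $x,y\in\mathfrak{n}$. A left invariant Hermitian metric is a left invariant Riemannian metric $g$ with $g(JX,JY)=g(X,Y)$ for all $X,Y$. A Killing-Yano (KY) tensor on a Riemannian manifold $(M,g)$ is an endomorphism field $T$ of $TM$ that is skew-symmetric with respect to $g$ and satisfies $(\nabla_X T)Y=-(\nabla_Y T)X$ for all vector fields $X,Y$, where $\nabla$ is the Levi-Civita connection of $g$. It is parallel if $\nabla T=0$, and invertible if it is an invertible endomorphism of the tangent space at every point. *)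

(* Defs.v *)
From HB Require Import structures.
From mathcomp Require Import all_boot all_order all_algebra.
From mathcomp Require Import all_classical all_reals all_analysis.

Set Implicit Arguments.
Unset Strict Implicit.
Unset Printing Implicit Defensive.

Import Order.TTheory GRing.Theory Num.Theory.
Import numFieldNormedType.Exports.

Local Open Scope classical_set_scope.
Local Open Scope ring_scope.

(* A group with a topology; the compatibility of the two is part of
   [lie_group] below. *)
#[short(type="groupTopType")]
HB.structure Definition GroupTop := {G of Topological G & Group G}.

Section Smoothness.
Context {R : realType}.

(* C^k on an open subset U of a finite-dimensional space V, by recursion on
   the directional derivatives x |-> 'd f x v. *)
Fixpoint Ck_on (k : nat) {V W : normedModType R} (U : set V) (f : V -> W)
    : Prop :=
  match k with
  | 0%N => forall x, U x -> {for x, continuous f}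
  | k'.+1 => (forall x, U x -> differentiable f x) /\
             forall v : V, Ck_on k' U (fun x => 'd f x v)
  end.

Definition smooth_on {V W : normedModType R} (U : set V) (f : V -> W) : Prop :=
  forall k, Ck_on k U f.

(* Cauchy-Riemann: the real differential intertwines the complex structures. *)
Definition holomorphic_on {V W : normedModType R} (JV : V -> V) (JW : W -> W)
    (U : set V) (f : V -> W) : Prop :=
  smooth_on U f /\ forall x, U x -> forall v, 'd f x (JV v) = JW ('d f x v).

(* C^m as the real normed space R^m x R^m, (x, y) standing for x + i y. *)
Definition Cspace (m : nat) : normedModType R :=
  ('rV[R]_m * 'rV[R]_m)%type.

Definition mulI {m : nat} (u : Cspace m) : Cspace m := (- u.2, u.1).

Definition mulI2 {m : nat} (u : (Cspace m * Cspace m)%type)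
  : (Cspace m * Cspace m)%type := (mulI u.1, mulI u.2).

End Smoothness.

(* A smooth atlas on M with model space V, indexed by the points of M: the
   chart of index p is a homeomorphism from the open set [chart_dom p],
   which contains p, onto an open subset of V, with inverse [param p].  (Any
   atlas gives one of this form with the same smooth structure, by choosing a
   chart around each point.) *)
Record atlas (R : realType) (V : normedModType R) (M : topologicalType) :=
  Atlas {
  chart_dom : M -> set M;
  chart : M -> M -> V;
  param : M -> V -> M;
  chart_dom_open : forall p, open (chart_dom p);
  chart_dom_center : forall p, chart_dom p p;
  chart_image_open : forall p, open (chart p @` chart_dom p);
  chartK : forall p x, chart_dom p x -> param p (chart p x) = x;
  chart_continuous : forall p x, chart_dom p x -> {for x, continuous (chart p)};
  param_continuous : forall p y, (chart p @` chart_dom p) y ->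
    {for y, continuous (param p)};
  transition_smooth : forall p q,
    smooth_on (chart p @` (chart_dom p `&` chart_dom q)) (chart q \o param p)
}.

(* The tangent space at p is identified with V through the chart of index p.
   So a tangent vector at p, a vector field, a bilinear form on TM and an
   endomorphism field of TM are respectively elements of V, M -> V,
   M -> V -> V -> R and M -> V -> V. *)
Section Manifold.
Context {R : realType} {V : normedModType R} {M : topologicalType}.
Variable A : atlas V M.

Local Notation chart_im q := (chart A q @` chart_dom A q).

Definition smooth_fun (f : M -> R) : Prop :=
  forall q, smooth_on (chart_im q) (f \o param A q : V -> R^o).

(* The expression of the vector field X in the coordinates of chart q. *)
Definition local_field (X : M -> V) (q : M) (y : V) : V :=
  let p := param A q y in 'd (chart A q \o param A p) (chart A p p) (X p).

Definition smooth_field (X : M -> V) : Prop :=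
  forall q, smooth_on (chart_im q) (local_field X q).

(* The derivative X f of the function f along the vector field X. *)
Definition dirder (X : M -> V) (f : M -> R) (p : M) : R :=
  'd (f \o param A p : V -> R^o) (chart A p p) (X p).

(* The Lie bracket of vector fields: [X, Y] = DY(X) - DX(Y) in coordinates. *)
Definition bracket (X Y : M -> V) (p : M) : V :=
  'd (local_field Y p) (chart A p p) (X p)
  - 'd (local_field X p) (chart A p p) (Y p).

Definition tangent_map (F : M -> M) (p : M) : V -> V :=
  'd (chart A (F p) \o F \o param A p) (chart A p p).

Record riemannian_metric (g : M -> V -> V -> R) : Prop := {
  metric_sym : forall p u v, g p u v = g p v u;
  metric_linear : forall p (a : R) u v w,
    g p (a *: u + v) w = a * g p u w + g p v w;
  metric_posdef : forall p u, u != 0 -> 0 < g p u u;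
  metric_smooth : forall X Y, smooth_field X -> smooth_field Y ->
    smooth_fun (fun p => g p (X p) (Y p))
}.

(* nabla X Y is the covariant derivative of Y along X; its values on
   non-smooth arguments are irrelevant. *)
Record levi_civita (g : M -> V -> V -> R)
    (nabla : (M -> V) -> (M -> V) -> M -> V) : Prop := {
  lc_smooth : forall X Y, smooth_field X -> smooth_field Y ->
    smooth_field (nabla X Y);
  lc_linearl : forall f X X' Y, smooth_fun f ->
    smooth_field X -> smooth_field X' -> smooth_field Y ->
    forall p, nabla (fun x => f x *: X x + X' x) Y p
              = f p *: nabla X Y p + nabla X' Y p;
  lc_additiver : forall X Y Y',
    smooth_field X -> smooth_field Y -> smooth_field Y' ->
    forall p, nabla X (fun x => Y x + Y' x) p = nabla X Y p + nabla X Y' p;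
  lc_leibniz : forall f X Y, smooth_fun f ->
    smooth_field X -> smooth_field Y ->
    forall p, nabla X (fun x => f x *: Y x) p
              = dirder X f p *: Y p + f p *: nabla X Y p;
  lc_torsion_free : forall X Y, smooth_field X -> smooth_field Y ->
    forall p, nabla X Y p - nabla Y X p = bracket X Y p;
  lc_metric : forall X Y Z,
    smooth_field X -> smooth_field Y -> smooth_field Z ->
    forall p, dirder X (fun x => g x (Y x) (Z x)) p
              = g p (nabla X Y p) (Z p) + g p (Y p) (nabla X Z p)
}.

Record endomorphism_field (T : M -> V -> V) : Prop := {
  endo_linear : forall p, linear (T p);
  endo_smooth : forall X, smooth_field X -> smooth_field (fun p => T p (X p))
}.

(* (nabla_X T) Y *)
Definition nabla_endo (nabla : (M -> V) -> (M -> V) -> M -> V)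
    (T : M -> V -> V) (X Y : M -> V) (p : M) : V :=
  nabla X (fun x => T x (Y x)) p - T p (nabla X Y p).

Record killing_yano (g : M -> V -> V -> R)
    (nabla : (M -> V) -> (M -> V) -> M -> V) (T : M -> V -> V) : Prop := {
  ky_endo : endomorphism_field T;
  ky_skew : forall p u v, g p (T p u) v = - g p u (T p v);
  ky_eq : forall X Y, smooth_field X -> smooth_field Y ->
    forall p, nabla_endo nabla T X Y p = - nabla_endo nabla T Y X p
}.

Definition parallel_endo (nabla : (M -> V) -> (M -> V) -> M -> V)
    (T : M -> V -> V) : Prop :=
  forall X Y, smooth_field X -> smooth_field Y ->
    forall p, nabla_endo nabla T X Y p = 0.

Definition invertible_endo (T : M -> V -> V) : Prop :=
  forall p, bijective (T p).

End Manifold.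

Section LieGroup.
Context {R : realType} {V : normedModType R} {N : groupTopType}.
Variable A : atlas V N.

(* The multiplication read in the charts p, q at the source and r at the
   target, and the open set on which this makes sense. *)
Definition mul_local (p q r : N) (u : (V * V)%type) : V :=
  chart A r (param A p u.1 * param A q u.2)%g.

Definition mul_local_dom (p q r : N) : set (V * V)%type :=
  [set u | [/\ (chart A p @` chart_dom A p) u.1,
               (chart A q @` chart_dom A q) u.2 &
               chart_dom A r (param A p u.1 * param A q u.2)%g]].

Definition inv_local (p r : N) (u : V) : V := chart A r (param A p u)^-1%g.

Definition inv_local_dom (p r : N) : set V :=
  [set u | (chart A p @` chart_dom A p) u /\ chart_dom A r (param A p u)^-1%g].

Record lie_group : Prop := {
  lie_hausdorff : hausdorff_space N;
  lie_second_countable : @second_countable N;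
  lie_mul_continuous : continuous (fun ab : (N * N)%type => (ab.1 * ab.2)%g);
  lie_inv_continuous : continuous (fun a : N => a^-1%g);
  lie_mul_smooth : forall p q r,
    smooth_on (mul_local_dom p q r) (mul_local p q r);
  lie_inv_smooth : forall p r, smooth_on (inv_local_dom p r) (inv_local p r)
}.

Definition left_translation (a b : N) : N := (a * b)%g.

(* The Lie algebra of N: the smooth left invariant vector fields. *)
Definition lie_algebra : set (N -> V) :=
  [set X | smooth_field A X /\
           forall a p, X (a * p)%g = tangent_map A (left_translation a) p (X p)].

Definition two_step_nilpotent : Prop :=
  (exists X Y, [/\ lie_algebra X, lie_algebra Y &
                   exists p, bracket A X Y p <> 0]) /\
  (forall X Y Z, lie_algebra X -> lie_algebra Y -> lie_algebra Z ->
     forall p, bracket A (bracket A X Y) Z p = 0).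

Definition left_invariant_metric (g : N -> V -> V -> R) : Prop :=
  forall a p u v,
    g (a * p)%g (tangent_map A (left_translation a) p u)
                (tangent_map A (left_translation a) p v) = g p u v.

End LieGroup.

Section ComplexLieGroup.
Context {R : realType} {m : nat} {N : groupTopType}.
Variable A : atlas (Cspace m : normedModType R) N.

Record complex_lie_group : Prop := {
  clg_lie_group : lie_group A;
  clg_transition : forall p q,
    holomorphic_on mulI mulI
      (chart A p @` (chart_dom A p `&` chart_dom A q)) (chart A q \o param A p);
  clg_mul : forall p q r,
    holomorphic_on mulI2 mulI (mul_local_dom A p q r) (mul_local A p q r);
  clg_inv : forall p r,
    holomorphic_on mulI mulI (inv_local_dom A p r) (inv_local A p r)
}.

(* Multiplication by i on T_p N.  As the transition maps are holomorphic, it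
   is [mulI] in every chart around p; as the multiplication is holomorphic, it
   is bi-invariant. *)
Definition complex_structure (p : N) (u : Cspace m) : (Cspace m : normedModType R)
  := mulI u.

Definition hermitian_metric (g : N -> (Cspace m : normedModType R) -> Cspace m -> R)
    : Prop :=
  forall p u v, g p (complex_structure p u) (complex_structure p v) = g p u v.

End ComplexLieGroup.

(* Main.v *)
(* Let n be the Lie algebra of N, z its center, P the orthogonal projection onto
   z, and let T be the left invariant endomorphism J (1 + 2 P), that is, 3 J on z
   and J on the orthogonal complement of z; it is skew and invertible.  Put
   k(u, v, w) = <[u, v], J w>.  As z is stable under J, contains [n, n], and J is
   bi-invariant, <[T u, v], w> = - k(u, v, w) and <[u, v], T w> = 3 k(u, v, w).
   Inserting this in Koszul's formula gives, for left invariant u, v, w,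
     <(nabla_u T) v, w> = k(u, v, w) + k(v, w, u) + k(w, u, v),
   which is skew in u, v; by tensoriality T is Killing-Yano.  For w = - J [u, v],
   which is central, the right-hand side is |[u, v]|^2, so T is not parallel.

   On the manifold side one needs that left invariant fields are smooth, that
   their brackets are left invariant, and that these brackets are complex
   bilinear.  The last two facts rest on the symmetry of second derivatives. *)
From HB Require Import structures.
Require Import Defs.
From mathcomp Require Import all_boot all_order all_algebra.
From mathcomp Require Import all_classical all_reals all_analysis.
From mathcomp Require Import ring lra.

Set Implicit Arguments.
Unset Strict Implicit.
Unset Printing Implicit Defensive.

Import Order.TTheory GRing.Theory Num.Theory.
Import numFieldNormedType.Exports.

Local Open Scope classical_set_scope.
Local Open Scope ring_scope.

(** * Differentials *)

Section Differentials.
Context {R : realType}.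
Implicit Types U V W : normedModType R.

(** A differential is determined by its first order expansion ([diff_unique]), and the remainder
    only sees values near [x]. *)
Lemma near_eq_is_diff V W (f g df : V -> W) x :
  (\forall y \near x, f y = g y) -> is_diff x f df -> is_diff x g df.
Proof.
move=> fg [dfx <-].
have [dfc /eqaddoP fE] := (diff_locallyP x f).1 dfx.
have gE : g \o shift x = cst (g x) + 'd f x +o_ 0 id.
  apply/eqaddoP => e e0; have := fE e e0; apply: filter_app.
  have fg0 : \forall h \near 0, f (h + x) = g (h + x).
    by move: fg; rewrite (near_shift 0 x) /= subr0; apply: filterS => h.
  near=> h; rewrite /= !fctE /= => fh; rewrite -(near fg0 h) //.
  by rewrite -(nbhs_singleton fg).
have dgE := diff_unique dfc gE.
apply: DiffDef; last exact: dgE.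
by apply/diff_locallyP; rewrite dgE.
Unshelve. all: by end_near. Qed.

Lemma open_eq_is_diff V W (D : set V) (f g df : V -> W) x : open D -> D x ->
  (forall y, D y -> f y = g y) -> is_diff x f df -> is_diff x g df.
Proof.
move=> oD Dx fg; apply: near_eq_is_diff.
have := open_nbhs_nbhs (conj oD Dx); apply: filterS => y Dy.
exact: fg.
Qed.

Lemma is_diff_add V W (f df g dg : V -> W) x :
  is_diff x f df -> is_diff x g dg ->
  is_diff x (fun y => f y + g y) (fun v => df v + dg v).
Proof. exact: is_diffD. Qed.

Lemma is_diff_sub V W (f df g dg : V -> W) x :
  is_diff x f df -> is_diff x g dg ->
  is_diff x (fun y => f y - g y) (fun v => df v - dg v).
Proof. exact: is_diffB. Qed.

Lemma is_diff_addr V W (f df : V -> W) (a : W) x :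
  is_diff x f df -> is_diff x (fun y => f y + a) df.
Proof.
move=> fx; have := is_diff_add fx (is_diff_cst a x).
by move=> h; apply: is_diff_eq h _; rewrite funeqE => v; exact: addr0.
Qed.

Lemma is_diff_linear V W (f : {linear V -> W}) x :
  continuous f -> is_diff x f f.
Proof.
by move=> fc; apply: DiffDef; [exact: linear_differentiable|exact: diff_lin].
Qed.

Lemma scale_is_bilinear W : bilinear_for
    (GRing.Scale.Law.clone _ _ *:%R _) (GRing.Scale.Law.clone _ _ *:%R _)
    (@GRing.scale R W : R^o -> W -> W).
Proof.
split=> [u'|u] a x y /=.
- by rewrite scalerDl scalerA.
- by rewrite scalerDr !scalerA mulrC.
Qed.

Lemma is_diff_scale V W (f df : V -> R^o) (g dg : V -> W) x :
  is_diff x f df -> is_diff x g dg ->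
  is_diff x (fun y => f y *: g y) (fun v => df v *: g x + f x *: dg v).
Proof.
move=> fx gx.
pose s : {bilinear R^o -> W -> W} := HB.pack (@GRing.scale R W : R^o -> W -> W)
  (bilinear_isBilinear.Build R R^o W W _ _ _ (@scale_is_bilinear W)).
have sc : continuous (fun p : R^o * W => s p.1 p.2).
  by move=> p; apply: scale_continuous.
have : is_diff (f x, g x) (fun p : R^o * W => s p.1 p.2)
    (fun q => s (f x) q.2 + s q.1 (g x)).
  by apply: DiffDef; [exact: differentiable_bilin|rewrite diff_bilin].
move=> h; have := is_diff_comp (is_diff_pair fx gx) h.
move=> h'; apply: is_diff_eq h' _; rewrite funeqE => v /=.
by rewrite addrC.
Qed.

Lemma is_diff_sum V W (I : Type) (r : seq I) (P : pred I) (f df : I -> V -> W)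
    x : (forall i, is_diff x (f i) (df i)) ->
  is_diff x (fun y => \sum_(i <- r | P i) f i y)
    (fun v => \sum_(i <- r | P i) df i v).
Proof.
move=> fx; rewrite [F in is_diff _ F _](_ : _ = \sum_(i <- r | P i) f i);
  last by rewrite funeqE => y; rewrite fct_sumE.
rewrite [F in is_diff _ _ F](_ : _ = \sum_(i <- r | P i) df i);
  last by rewrite funeqE => y; rewrite fct_sumE.
elim/big_ind2 : _ => // [|f1 df1 f2 df2 h1 h2]; first exact: is_diff_cst.
exact: is_diffD.
Qed.

End Differentials.

(** * Calculus of smooth functions *)

Section SmoothFunctions.
Context {R : realType}.
Implicit Types U V W : normedModType R.

(** Since [D] is open, equality on [D] passes to the differentials, so the recursion on [k] goes
    through whatever happens outside [D]. *)
Lemma Ck_on_eq k V W (D : set V) (f g : V -> W) : open D ->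
  (forall x, D x -> f x = g x) -> Ck_on k D f -> Ck_on k D g.
Proof.
move=> oD; elim: k f g => [|k IH] f g fg /=.
  move=> fc x Dx; suff : g y @[y --> x] --> f x by rewrite fg.
  apply: cvg_trans (fc x Dx); apply: near_eq_cvg.
  have := open_nbhs_nbhs (conj oD Dx); apply: filterS => y Dy.
  exact: fg.
move=> [fd fk].
have gd x : D x -> is_diff x g ('d f x).
  by move=> Dx; apply: open_eq_is_diff fg _ => //; apply/differentiableP/fd.
split=> [x Dx|v]; first by have := gd _ Dx; case.
apply: (IH (fun x => 'd f x v)); last exact: fk.
by move=> x Dx; have [_ ->] := gd _ Dx.
Qed.

Lemma Ck_on_le k V W (D : set V) (f : V -> W) : Ck_on k.+1 D f -> Ck_on k D f.
Proof.
elim: k f => [|k IH] f [fd fk] /=.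
  by move=> x Dx; apply: differentiable_continuous; apply: fd.
by split=> // v; apply: IH; apply: fk.
Qed.

Lemma smooth_on_diff V W (D : set V) (f : V -> W) x : smooth_on D f -> D x ->
  is_diff x f ('d f x).
Proof. by move=> /(_ 1%N)[fd _] Dx; apply/differentiableP/fd. Qed.

Lemma smooth_on_derive V W (D : set V) (f : V -> W) v : smooth_on D f ->
  smooth_on D (fun x => 'd f x v).
Proof. by move=> fs k; have [_] := fs k.+1; apply. Qed.

Lemma smooth_on_eq V W (D : set V) (f g : V -> W) : open D ->
  (forall x, D x -> f x = g x) -> smooth_on D f -> smooth_on D g.
Proof. by move=> oD fg fs k; apply: Ck_on_eq (fs k). Qed.

Lemma Ck_onD k V W (D : set V) (f g : V -> W) : open D ->
  Ck_on k D f -> Ck_on k D g -> Ck_on k D (fun x => f x + g x).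
Proof.
move=> oD; elim: k f g => [|k IH] f g /=.
  by move=> fc gc x Dx; apply: continuousD; [exact: fc|exact: gc].
move=> [fd fk] [gd gk].
have fgd x : D x -> is_diff x (f + g) (('d f x : V -> W) + ('d g x : V -> W)).
  by move=> Dx; apply: is_diffD; apply/differentiableP; [exact: fd|exact: gd].
split=> [x Dx|v]; first by have := fgd _ Dx; case.
apply: (Ck_on_eq oD _ (IH _ _ (fk v) (gk v))) => x Dx.
by have [_ ->] := fgd _ Dx.
Qed.

(** Each term of the product rule pairs a derivative with an undifferentiated factor; the latter is
    lowered to order [k] by [Ck_on_le]. *)
Lemma Ck_on_scale k V W (D : set V) (f : V -> R^o) (g : V -> W) : open D ->
  Ck_on k D f -> Ck_on k D g -> Ck_on k D (fun x => f x *: g x).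
Proof.
move=> oD; elim: k f g => [|k IH] f g.
  by move=> fc gc x Dx; apply: continuousZ; [exact: fc|exact: gc].
move=> fk1 gk1; have [fd fk] := fk1; have [gd gk] := gk1.
have fgd x : D x -> is_diff x (fun y => f y *: g y)
    (fun v => 'd f x v *: g x + f x *: 'd g x v).
  by move=> Dx; apply: is_diff_scale; apply/differentiableP;
    [exact: fd|exact: gd].
split=> [x Dx|v]; first by have := fgd _ Dx; case.
apply: (Ck_on_eq (f := fun x => 'd f x v *: g x + f x *: 'd g x v) oD)
  => [x Dx|].
  by have [_ ->] := fgd _ Dx.
apply: Ck_onD => //; first exact: IH (fk v) (Ck_on_le gk1).
exact: IH (Ck_on_le fk1) (gk v).
Qed.

Lemma smooth_onD V W (D : set V) (f g : V -> W) : open D ->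
  smooth_on D f -> smooth_on D g -> smooth_on D (fun x => f x + g x).
Proof. by move=> oD fs gs k; apply: Ck_onD. Qed.

Lemma smooth_on_scale V W (D : set V) (f : V -> R^o) (g : V -> W) : open D ->
  smooth_on D f -> smooth_on D g -> smooth_on D (fun x => f x *: g x).
Proof. by move=> oD fs gs k; apply: Ck_on_scale. Qed.

(* [h] is affine: its differential does not depend on the point. *)
Lemma smooth_on_comp_affine U V W (E : set U) (D : set V) (h dh : U -> V)
    (f : V -> W) : open E -> (forall x, is_diff x h dh) ->
  (forall x, E x -> D (h x)) -> smooth_on D f -> smooth_on E (f \o h).
Proof.
move=> oE hd hED fs k; move: (fs k) => {fs}; elim: k f => [|k IH] f /=.
  move=> fc x Ex; apply: continuous_comp; last exact/fc/hED.
  by apply: differentiable_continuous; have := hd x; case.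
move=> [fd fk].
have fhd x : E x -> is_diff x (f \o h) ('d f (h x) \o dh).
  by move=> Ex; apply: is_diff_comp; exact/differentiableP/fd/hED.
split=> [x Ex|v]; first by have := fhd _ Ex; case.
apply: (Ck_on_eq oE _ (IH _ (fk (dh v)))) => x Ex /=.
by have [_ ->] := fhd _ Ex.
Qed.

Lemma smooth_on_linear V W W' (D : set V) (f : V -> W) (l : {linear W -> W'}) :
  open D -> continuous l -> smooth_on D f -> smooth_on D (l \o f).
Proof.
move=> oD lc fs k; move: (fs k) => {fs}; elim: k f => [|k IH] f /=.
  move=> fc x Dx; apply: continuous_comp; [exact: fc|exact: lc].
move=> [fd fk].
have lfd x : D x -> is_diff x (l \o f) (l \o 'd f x).
  move=> Dx; apply: is_diff_comp; first exact/differentiableP/fd.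
  exact: is_diff_linear.
split=> [x Dx|v]; first by have := lfd _ Dx; case.
apply: (Ck_on_eq oD _ (IH _ (fk v))) => x Dx /=.
by have [_ ->] := lfd _ Dx.
Qed.

End SmoothFunctions.

(** * Symmetry of second derivatives *)

Section Schwarz.
Context {R : realType}.
Implicit Types V W : normedModType R.

Lemma is_derive_line V (f : V -> R^o) (a u : V) (s : R) :
  differentiable f (a + s *: u) ->
  is_derive (s : R^o) 1 (fun r : R => f (a + r *: u)) ('d f (a + s *: u) u).
Proof.
move=> df; have dl : is_diff (s : R^o) (fun r : R^o => a + r *: u)
    (fun r => r *: u).
  rewrite [F in is_diff _ F _](_ : _ = fun r => r *: u + a).
    exact: is_diff_addr (is_diff_scalel s u).
  by rewrite funeqE => r; rewrite addrC.
have {}df : is_diff (a + s *: u) f ('d f (a + s *: u)) by exact/differentiableP.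
have [dfl dflE] := is_diff_comp dl df.
apply: DeriveDef; first exact: diff_derivable dfl.
have -> := deriveE (1 : R^o) dfl.
by rewrite dflE /= scale1r.
Qed.

Lemma line_mean_value V (f : V -> R^o) (a u : V) (h : R) : 0 < h ->
  (forall s, 0 <= s <= h -> differentiable f (a + s *: u)) ->
  exists2 s, 0 < s < h & f (a + h *: u) - f a = h * 'd f (a + s *: u) u.
Proof.
move=> h0 df.
have [||s + sE] := @MVT R (fun r : R => f (a + r *: u) : R)
    (fun s => 'd f (a + s *: u) u) 0 h h0.
- move=> s; rewrite in_itv /= => /andP[s0 sh].
  by apply: is_derive_line; apply: df; rewrite !ltW.
- apply: derivable_within_continuous => s; rewrite in_itv /= => sh.
  by have [] := is_derive_line (df _ sh).
rewrite in_itv /= => sh; exists s => //.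
by move: sE; rewrite scale0r addr0 subr0 mulrC.
Qed.

(** The mean value theorem is used twice: along [u] for the increment [G y = f (y + h *: v) - f y],
    then along [v] for the derivative of [f] in direction [u]. *)
Lemma second_difference V (f : V -> R^o) (x u v : V) (h : R) (D : set V) :
  0 < h -> smooth_on D f ->
  (forall s t, 0 <= s <= h -> 0 <= t <= h -> D (x + s *: u + t *: v)) ->
  exists s t, [/\ 0 < s < h, 0 < t < h &
    f (x + h *: u + h *: v) - f (x + h *: u) - (f (x + h *: v) - f x)
    = h ^+ 2 * 'd (fun y => 'd f y u) (x + s *: u + t *: v) v].
Proof.
move=> h0 fs hD.
have hh : 0 <= h <= h by rewrite lexx ltW.
have h00 : (0 : R) <= 0 <= h by rewrite lexx ltW.
pose G (y : V) : R^o := f (y + h *: v) - f y.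
have Gd y : D y -> D (y + h *: v) ->
    is_diff y G (fun w => 'd f (y + h *: v) w - 'd f y w).
  move=> Dy Dyv; apply: is_diff_sub; last exact: smooth_on_diff Dy.
  have sh := is_diff_addr (h *: v) (is_diff_id y).
  exact: is_diff_comp sh (smooth_on_diff fs Dyv).
have GD s : 0 <= s <= h -> is_diff (x + s *: u) G
    (fun w => 'd f (x + s *: u + h *: v) w - 'd f (x + s *: u) w).
  move=> sh; apply: Gd; last exact: hD.
  by have := hD s 0 sh h00; rewrite scale0r addr0.
have [s sh0|s sh sE] := @line_mean_value _ G x u h h0.
  by have [] := GD s sh0.
have sh' : 0 <= s <= h by case/andP: sh => s0 s1; rewrite !ltW.
have fus := smooth_on_derive u fs.
have [t th0|t th tE] :=
    @line_mean_value _ (fun y => 'd f y u) (x + s *: u) v h h0.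
  by have [] := smooth_on_diff fus (hD s t sh' th0).
exists s, t; split=> //.
have [_ dGE] := GD s sh'.
by rewrite expr2 -mulrA -tE -[LHS]/(G (x + h *: u) - G x) sE dGE.
Qed.

(** The second difference is symmetric in [u] and [v], so the two mixed derivatives take a common
    value at points arbitrarily close to [x]; by continuity they cannot differ at [x]. *)
Lemma schwarz_real V (D : set V) (f : V -> R^o) x u v : open D ->
  smooth_on D f -> D x ->
  'd (fun y => 'd f y u) x v = 'd (fun y => 'd f y v) x u.
Proof.
move=> oD fs Dx.
pose A y : R^o := 'd (fun y => 'd f y u) y v.
pose B y : R^o := 'd (fun y => 'd f y v) y u.
rewrite -[LHS]/(A x) -[RHS]/(B x); apply/eqP/negP => /negP AB.
pose e := `|A x - B x| / 2.
have e0 : 0 < e by rewrite divr_gt0 // normr_gt0 subr_eq0.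
have Ac : {for x, continuous A}.
  exact: (smooth_on_derive v (smooth_on_derive u fs)) 0%N _ Dx.
have Bc : {for x, continuous B}.
  exact: (smooth_on_derive u (smooth_on_derive v fs)) 0%N _ Dx.
have : \forall y \near x, [/\ D y, `|A x - A y| < e & `|B x - B y| < e].
  near=> y; split; near: y.
  - exact: open_nbhs_nbhs (conj oD Dx).
  - by move/cvgrPdist_lt : Ac; apply.
  - by move/cvgrPdist_lt : Bc; apply.
move=> /nbhs_normP [d /= d0 xd].
(* The parallelogram with sides [h *: u] and [h *: v] then stays in the ball of radius [d]; the
   summand 1 keeps the denominator positive when [u] and [v] vanish. *)
pose h := d / (`|u| + `|v| + 1).
have k0 : 0 < `|u| + `|v| + 1 by rewrite ltr_wpDl // addr_ge0.
have h0 : 0 < h by rewrite divr_gt0.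
have near_x s t : 0 <= s <= h -> 0 <= t <= h ->
    ball_ Num.norm x d (x + s *: u + t *: v).
  move=> /andP[s0 sh] /andP[t0 th].
  rewrite /ball_ /= -addrA opprD addNKr normrN.
  rewrite (le_lt_trans (ler_normD _ _)) // !normrZ !ger0_norm //.
  rewrite (@le_lt_trans _ _ (h * (`|u| + `|v|))) //.
    by rewrite mulrDr lerD // ler_wpM2r.
  by rewrite /h mulrAC ltr_pdivrMr // ltr_pM2l // ltrDl.
have hD s t : 0 <= s <= h -> 0 <= t <= h -> D (x + s *: u + t *: v).
  by move=> sh th; have [] := xd _ (near_x s t sh th).
have hD' s t : 0 <= s <= h -> 0 <= t <= h -> D (x + s *: v + t *: u).
  by move=> sh th; rewrite addrAC; exact: hD.
have [s [t [sh th sE]]] := second_difference h0 fs hD.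
(* The roles of [u] and [v] are exchanged: [t'] is the coefficient of [v] and [s'] that of [u]. *)
have [t' [s' [th' sh' tE]]] := second_difference h0 fs hD'.
have lte r : 0 < r < h -> 0 <= r <= h by move=> /andP[? ?]; rewrite !ltW.
have [_ Ae _] := xd _ (near_x s t (lte _ sh) (lte _ th)).
have [_ _ Be] := xd _ (near_x s' t' (lte _ sh') (lte _ th')).
have AE : A (x + s *: u + t *: v) = B (x + s' *: u + t' *: v).
  have h2 : h ^+ 2 != 0 by rewrite expf_neq0 // gt_eqF.
  apply: (mulfI h2).
  rewrite -[LHS]sE [in RHS]addrAC -[RHS]tE [x + h *: v + h *: u]addrAC.
  by rewrite !opprB !addrA addrAC [RHS]addrAC [X in X + _ = _]addrAC.
have : `|A x - B x| < e + e.
  rewrite (_ : A x - B x = (A x - A (x + s *: u + t *: v))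
     - (B x - B (x + s' *: u + t' *: v))).
    exact: le_lt_trans (ler_normB _ _) (ltrD Ae Be).
  by rewrite AE opprB addrA subrK.
by rewrite -splitr ltxx.
Unshelve. all: by end_near. Qed.

End Schwarz.

(** * Vector-valued second derivatives through finite coordinates *)

Section Coordinates.
Context {R : realType}.
Implicit Types V W : normedModType R.

(** Finite dimensionality, in the form that reduces vector-valued statements to real-valued ones. *)
Definition has_coordinates V := exists (I : finType)
  (l : I -> {linear V -> R^o}) (e : I -> V),
  (forall i, continuous (l i)) /\ forall v, v = \sum_i l i v *: e i.

Lemma has_coordinates_Cspace m : has_coordinates (@Cspace R m).
Proof.
pose l (s : 'I_m + 'I_m) (v : @Cspace R m) : R^o :=
  match s with inl i => v.1 0 i | inr i => v.2 0 i end.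
have l_linear s : linear (l s) by case: s => i a u v; rewrite /l /= !mxE.
pose L s : {linear @Cspace R m -> R^o} :=
  HB.pack (l s) (GRing.isLinear.Build _ _ _ _ (l s) (l_linear s)).
exists ('I_m + 'I_m)%type, L, (fun s => match s with
  | inl i => (delta_mx 0 i, 0) | inr i => (0, delta_mx 0 i) end).
split=> [[i|i] v|[v w]].
- apply: (@continuous_comp _ _ _ fst (fun M : 'rV[R]_m => M 0 i)).
    exact: cvg_fst.
  exact: coord_continuous.
- apply: (@continuous_comp _ _ _ snd (fun M : 'rV[R]_m => M 0 i)).
    exact: cvg_snd.
  exact: coord_continuous.
have fstD : {morph (fst : @Cspace R m -> 'rV[R]_m) : u w / u + w} by [].
have sndD : {morph (snd : @Cspace R m -> 'rV[R]_m) : u w / u + w} by [].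
rewrite big_sumType /=; apply: injective_projections.
- rewrite fstD !(big_morph _ fstD (erefl _)) /= [X in _ + X]big1 => [|i _].
    by rewrite addr0 -row_sum_delta.
  by rewrite scaler0.
- rewrite sndD !(big_morph _ sndD (erefl _)) /= [X in X + _]big1 => [|i _].
    by rewrite add0r -row_sum_delta.
  by rewrite scaler0.
Qed.

(** Continuous linear maps commute with differentials, so the real case applies to each coordinate
    [l i \o f]. *)
Lemma schwarz V W (D : set V) (f : V -> W) x u v : has_coordinates W ->
  open D -> smooth_on D f -> D x ->
  'd (fun y => 'd f y u) x v = 'd (fun y => 'd f y v) x u.
Proof.
move=> [I [l [e [lc lE]]]] oD fs Dx.
have ldE i w w' : l i ('d (fun y => 'd f y w) x w')
    = 'd (fun y => 'd (l i \o f) y w) x w'.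
  have := is_diff_comp (smooth_on_diff (smooth_on_derive w fs) Dx)
    (is_diff_linear _ (lc i)).
  move=> /(open_eq_is_diff (g := fun y => 'd (l i \o f) y w) oD Dx) [].
    move=> y Dy /=.
    by have [_ ->] := is_diff_comp (smooth_on_diff fs Dy)
      (is_diff_linear (f y) (lc i)).
  by move=> _ ->.
rewrite [LHS]lE [RHS]lE; apply: eq_bigr => i _; congr (_ *: _).
by rewrite !ldE; apply: (schwarz_real _ _ oD) => //; exact: smooth_on_linear.
Qed.

(** The direction [Y y] moves with the point, whereas [smooth_on] controls derivatives in fixed
    directions only. Expanding [Y y] in coordinates gives a finite sum of products covered by
    [is_diff_scale]. *)
Lemma is_diff_apply V W (D : set V) (f : V -> W) (Y dY : V -> V) x :
  has_coordinates V -> open D -> smooth_on D f -> D x -> is_diff x Y dY ->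
  is_diff x (fun y => 'd f y (Y y))
    (fun u => 'd (fun y => 'd f y (Y x)) x u + 'd f x (dY u)).
Proof.
move=> [I [l [e [lc lE]]]] oD fs Dx Yx.
have dfE y w : 'd f y w = \sum_i l i w *: 'd f y (e i).
  by rewrite {1}(lE w) linear_sum; apply: eq_bigr => i _; rewrite linearZ.
have fe i : is_diff x (fun y => 'd f y (e i)) ('d (fun y => 'd f y (e i)) x).
  exact: smooth_on_diff (smooth_on_derive _ fs) Dx.
have lY i : is_diff x (l i \o Y) (l i \o dY).
  exact: is_diff_comp Yx (is_diff_linear _ (lc i)).
have -> : (fun y => 'd f y (Y y))
    = (fun y => \sum_i (l i \o Y) y *: 'd f y (e i)).
  by rewrite funeqE => y; exact: dfE.
apply: is_diff_eq (is_diff_sum _ _ (fun i => is_diff_scale (lY i) (fe i))) _.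
rewrite funeqE => u; rewrite big_split /= addrC; congr (_ + _); last first.
  by rewrite [RHS]dfE.
(* The term with the direction frozen at [Y x] is expanded in the same way, with constant
   coefficients. *)
rewrite [F in 'd F x u](_ : _ =
    fun y => \sum_i cst (l i (Y x)) y *: 'd f y (e i)).
  have [_ ->] := is_diff_sum (index_enum I) xpredT
    (fun i => is_diff_scale (is_diff_cst (l i (Y x) : R^o) x) (fe i)).
  by apply: eq_bigr => i _; rewrite scale0r add0r.
by rewrite funeqE => y; exact: dfE.
Qed.

End Coordinates.

(** * Left invariant vector fields *)

Section Charts.
Context {R : realType} {V : normedModType R} {N : topologicalType}.
Context (A : atlas V N).

Definition chart_codom p : set V := chart A p @` chart_dom A p.

Lemma chart_codom_open p : open (chart_codom p).
Proof. exact: chart_image_open. Qed.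

Lemma chart_codomP p x : chart_dom A p x -> chart_codom p (chart A p x).
Proof. by move=> px; exists x. Qed.

Lemma param_dom p y : chart_codom p y -> chart_dom A p (param A p y).
Proof. by move=> [x px <-]; rewrite chartK. Qed.

Lemma paramK p y : chart_codom p y -> chart A p (param A p y) = y.
Proof. by move=> [x px <-]; rewrite chartK. Qed.

Lemma param_center p : param A p (chart A p p) = p.
Proof. exact/chartK/chart_dom_center. Qed.

Lemma chart_codom_center p : chart_codom p (chart A p p).
Proof. exact/chart_codomP/chart_dom_center. Qed.

Lemma open_param_preimage p (W : set N) : open W ->
  open [set y | chart_codom p y /\ W (param A p y)].
Proof.
move=> oW; rewrite openE => y [py Wy]; apply: filterI.
  exact: open_nbhs_nbhs (conj (chart_codom_open p) py).
by apply: (param_continuous py); exact: open_nbhs_nbhs.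
Qed.

End Charts.

Section LieGroups.
Context {R : realType} {V : normedModType R} {N : groupTopType}.
Context (A : atlas V N) (HA : lie_group A).

Lemma continuous_mull (a : N) : continuous (fun x : N => (a * x)%g).
Proof.
move=> x; apply: (@continuous_comp _ _ _ (fun x : N => (a, x))
    (fun z : N * N => (z.1 * z.2)%g)); last exact: (lie_mul_continuous HA).
by apply: cvg_pair; [exact: cvg_cst|exact: cvg_id].
Qed.

Lemma mul_local_dom_open p q r : open (mul_local_dom A p q r).
Proof.
rewrite openE => -[y1 y2] /= [y1p y2q y12].
have fc : {for (y1, y2), continuous (fst : V * V -> V)} by exact: cvg_fst.
have sc : {for (y1, y2), continuous (snd : V * V -> V)} by exact: cvg_snd.
have mc : {for (y1, y2), continuous (fun z : V * V =>
    (param A p z.1 * param A q z.2)%g)}.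
  apply: (@continuous_comp _ _ _
    (fun z : V * V => (param A p z.1, param A q z.2))
    (fun z : N * N => (z.1 * z.2)%g)); last exact: (lie_mul_continuous HA).
  apply: cvg_pair.
    apply: (@continuous_comp _ _ _ fst (param A p)); first exact: fc.
    exact: param_continuous.
  apply: (@continuous_comp _ _ _ snd (param A q)); first exact: sc.
  exact: param_continuous.
have h1 : \forall z \near (y1, y2), chart_codom A p z.1.
  exact: fc _ (open_nbhs_nbhs (conj (chart_codom_open A p) y1p)).
have h2 : \forall z \near (y1, y2), chart_codom A q z.2.
  exact: sc _ (open_nbhs_nbhs (conj (chart_codom_open A q) y2q)).
have h3 : \forall z \near (y1, y2),
    chart_dom A r (param A p z.1 * param A q z.2)%g.
  exact: mc _ (open_nbhs_nbhs (conj (chart_dom_open A r) y12)).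
by apply: filterS (filterI h1 (filterI h2 h3)) => z [z1 [z2 z3]].
Qed.

Definition ltrans a p r : V -> V :=
  chart A r \o left_translation a \o param A p.

Definition ltrans_dom a p r : set V :=
  [set y | chart_codom A p y /\ chart_dom A r (a * param A p y)%g].

Lemma ltrans_dom_open a p r : open (ltrans_dom a p r).
Proof.
apply: (@open_param_preimage _ _ _ A p
  ((fun x : N => (a * x)%g) @^-1` chart_dom A r)).
by apply: open_comp (chart_dom_open A r) => x _; exact: continuous_mull.
Qed.

Lemma ltrans_dom_center a p r : chart_dom A r (a * p)%g ->
  ltrans_dom a p r (chart A p p).
Proof.
by move=> h; split; rewrite ?param_center //; exact: chart_codom_center.
Qed.

Lemma ltransE a p r y : ltrans a p r y = chart A r (a * param A p y)%g.
Proof. by []. Qed.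

Lemma ltrans_center a p r : ltrans a p r (chart A p p) = chart A r (a * p)%g.
Proof. by rewrite ltransE param_center. Qed.

Lemma param_ltrans a p r y : ltrans_dom a p r y ->
  param A r (ltrans a p r y) = (a * param A p y)%g.
Proof. by move=> [_ h]; rewrite ltransE chartK. Qed.

Lemma is_diff_pair_cstl (b y : V) :
  is_diff y (fun w => (b, w)) (fun w : V => (0 : V, w)).
Proof. exact: is_diff_pair (is_diff_cst b y) (is_diff_id y). Qed.

Lemma is_diff_pair_cstr (b y : V) :
  is_diff y (fun w => (w, b)) (fun w : V => (w, 0 : V)).
Proof. exact: is_diff_pair (is_diff_id y) (is_diff_cst b y). Qed.

(** A left translation is the local multiplication restricted to the affine slice whose first
    coordinate is that of [a]. *)
Lemma ltrans_smooth a p r : smooth_on (ltrans_dom a p r) (ltrans a p r).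
Proof.
have -> : ltrans a p r = mul_local A a p r \o (fun y => (chart A a a, y)).
  by rewrite funeqE => y; rewrite /= /mul_local /= param_center.
apply: smooth_on_comp_affine (is_diff_pair_cstl _) _ (lie_mul_smooth HA a p r).
  exact: ltrans_dom_open.
move=> y [py ry]; split=> //=; first exact: chart_codom_center.
by rewrite param_center.
Qed.

Lemma ltrans_diff a p r y : ltrans_dom a p r y ->
  is_diff y (ltrans a p r) ('d (ltrans a p r) y).
Proof. exact/smooth_on_diff/ltrans_smooth. Qed.

(** The chain rule for the composite of the translations by [b] and by [a], read in three charts.
    The identities for left invariant fields below are instances of it. *)
Lemma diff_ltrans_comp a b p q r y v : ltrans_dom b p q y ->
  ltrans_dom (a * b)%g p r y ->
  'd (ltrans a q r) (ltrans b p q y) ('d (ltrans b p q) y v)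
  = 'd (ltrans (a * b)%g p r) y v.
Proof.
move=> by_ aby.
have ay : ltrans_dom a q r (ltrans b p q y).
  split; first by apply: chart_codomP; case: by_.
  by rewrite param_ltrans // mulgA; case: aby.
have := is_diff_comp (ltrans_diff by_) (ltrans_diff ay).
move=> /(near_eq_is_diff (g := ltrans (a * b)%g p r)) [].
  have := open_nbhs_nbhs (conj (ltrans_dom_open b p q) by_).
  apply: filterS => z bz /=.
  by rewrite ltransE param_ltrans // mulgA.
by move=> _ dE; exact: (esym (congr1 (fun h => h v) dE)).
Qed.

Lemma diff_ltrans1 p y v : chart_codom A p y -> 'd (ltrans 1%g p p) y v = v.
Proof.
move=> py; have := is_diff_id y.
move=> /(open_eq_is_diff (g := ltrans 1%g p p) (chart_codom_open A p) py) [].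
  by move=> z pz; rewrite ltransE mul1g paramK.
by move=> _ ->.
Qed.

(** Treating a change of chart as the translation by the unit lets [diff_ltrans_comp] handle
    coordinate changes too. *)
Lemma local_fieldE X q y : local_field A X q y =
  'd (ltrans 1%g (param A q y) q) (chart A (param A q y) (param A q y))
    (X (param A q y)).
Proof.
rewrite /local_field /=; congr ('d _ _ _).
by rewrite funeqE => z; rewrite ltransE mul1g.
Qed.

Lemma local_field_center X p : local_field A X p (chart A p p) = X p.
Proof.
rewrite local_fieldE param_center diff_ltrans1 //; exact: chart_codom_center.
Qed.

(** The left invariant field with value [v] at the unit. The target chart has index [p] because that
    chart identifies the tangent space at [p] with [V]. *)
Definition linv (v : V) (p : N) : V := 'd (ltrans p 1%g p) (chart A 1%g 1%g) v.

Lemma linv_dom p r : chart_dom A r p -> ltrans_dom p 1%g r (chart A 1%g 1%g).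
Proof. by move=> pr; apply: ltrans_dom_center; rewrite mulg1. Qed.

Lemma linv_dom1 p : ltrans_dom p 1%g p (chart A 1%g 1%g).
Proof. exact/linv_dom/chart_dom_center. Qed.

Lemma linv_linear p : linear (linv ^~ p).
Proof. by move=> a u v; rewrite /linv linearP. Qed.

Lemma linv1 v : linv v 1%g = v.
Proof. by rewrite /linv diff_ltrans1 //; exact: chart_codom_center. Qed.

Lemma tangent_map_linv a p v :
  tangent_map A (left_translation a) p (linv v p) = linv v (a * p)%g.
Proof.
rewrite /linv -(@diff_ltrans_comp a p 1%g p); last 2 first.
- exact: linv_dom1.
- exact: linv_dom1.
by rewrite ltrans_center mulg1.
Qed.

(** The preimage is [w] translated back to the unit by the inverse of [p]. *)
Lemma linv_surj p w : exists v, w = linv v p.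
Proof.
have pd : ltrans_dom p^-1%g p 1%g (chart A p p).
  by apply: ltrans_dom_center; rewrite mulVg; exact: chart_dom_center.
exists ('d (ltrans p^-1%g p 1%g) (chart A p p) w).
rewrite /linv.
have -> : chart A 1%g 1%g = ltrans p^-1%g p 1%g (chart A p p).
  by rewrite ltrans_center mulVg.
rewrite diff_ltrans_comp // mulgV.
  by rewrite diff_ltrans1 //; exact: chart_codom_center.
by apply: ltrans_dom_center; rewrite mul1g; exact: chart_dom_center.
Qed.

Lemma local_field_linv v q y : chart_codom A q y ->
  local_field A (linv v) q y
  = 'd (ltrans (param A q y) 1%g q) (chart A 1%g 1%g) v.
Proof.
move=> qy; rewrite local_fieldE; set p := param A q y.
have pq : chart_dom A q p by exact: param_dom.
rewrite /linv; have -> : chart A p p = ltrans p 1%g p (chart A 1%g 1%g).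
  by rewrite ltrans_center mulg1.
rewrite diff_ltrans_comp ?mul1g //; first exact: linv_dom1.
exact: linv_dom.
Qed.

Lemma mul_local_dom_slice q y : chart_codom A q y ->
  mul_local_dom A q 1%g q (y, chart A 1%g 1%g).
Proof.
move=> qy; split=> //=; first exact: chart_codom_center.
by rewrite param_center mulg1; exact: param_dom.
Qed.

(** The definition of [linv] changes chart with the point; here the field becomes, in one fixed
    chart, a partial derivative of the multiplication in its second factor. Smoothness and complex
    linearity both come from this form. *)
Lemma local_field_linvE v q y : chart_codom A q y ->
  local_field A (linv v) q y
  = 'd (mul_local A q 1%g q) (y, chart A 1%g 1%g) (0, v).
Proof.
move=> qy; rewrite local_field_linv //.
have -> : ltrans (param A q y) 1%g q = mul_local A q 1%g q \o (fun w => (y, w)).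
  by rewrite funeqE.
have [_ ->] := is_diff_comp (is_diff_pair_cstl y (chart A 1%g 1%g))
  (smooth_on_diff (lie_mul_smooth HA q 1%g q) (mul_local_dom_slice qy)).
by [].
Qed.

Lemma linv_smooth v : smooth_field A (linv v).
Proof.
move=> q.
apply: (smooth_on_eq (f := fun y =>
    'd (mul_local A q 1%g q) (y, chart A 1%g 1%g) (0, v))).
- exact: chart_codom_open.
- by move=> y qy; rewrite local_field_linvE.
have := smooth_on_derive (0, v) (lie_mul_smooth HA q 1%g q).
apply: smooth_on_comp_affine (chart_codom_open A q)
  (is_diff_pair_cstr (chart A 1%g 1%g)) _.
by move=> y qy; exact: mul_local_dom_slice.
Qed.

Lemma linv_lie_algebra v : lie_algebra A (linv v).
Proof.
by split=> [|a p]; [exact: linv_smooth|rewrite tangent_map_linv].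
Qed.

(** Left invariance at the unit expresses every value of [X] through [X 1%g]. *)
Lemma lie_algebraE X : lie_algebra A X -> X = linv (X 1%g).
Proof.
move=> [_ Xinv]; rewrite funeqE => p; rewrite -{1}[p]mulg1 Xinv.
by rewrite /tangent_map /left_translation mulg1.
Qed.

Lemma linv_local_diff v p y : chart_codom A p y ->
  is_diff y (local_field A (linv v) p) ('d (local_field A (linv v) p) y).
Proof. by move=> py; apply: smooth_on_diff py; exact: linv_smooth. Qed.

(** The bracket of the Lie algebra, carried over to the tangent space at the unit. *)
Definition lie_bracket (u v : V) : V := bracket A (linv u) (linv v) 1%g.

(* In the charts at [1] and [p], left translation by [p] maps [linv v] to
   itself; differentiating this along [linv u] gives a term involving the
   second derivative of the translation, symmetric in [u] and [v]. *)
Lemma diff_local_field_linv u v p (f := ltrans p 1%g p) (c := chart A 1%g 1%g) :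
  has_coordinates V ->
  'd (local_field A (linv v) p) (chart A p p) (linv u p)
  = 'd (fun y => 'd f y v) c u + 'd f c ('d (local_field A (linv v) 1%g) c u).
Proof.
move=> HV; have fs : smooth_on (ltrans_dom p 1%g p) f by exact: ltrans_smooth.
have fc : f c = chart A p p by rewrite /f ltrans_center mulg1.
have h1 : is_diff c (fun y => 'd f y (local_field A (linv v) 1%g y))
    (fun u => 'd (fun y => 'd f y v) c u
      + 'd f c ('d (local_field A (linv v) 1%g) c u)).
  have := is_diff_apply HV (ltrans_dom_open p 1%g p) fs (linv_dom1 p)
    (linv_local_diff v (chart_codom_center A 1%g)).
  by rewrite local_field_center linv1.
have h2 : is_diff c (local_field A (linv v) p \o f)
    ('d (local_field A (linv v) p) (chart A p p) \o 'd f c).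
  rewrite -fc; apply: is_diff_comp; first exact: ltrans_diff (linv_dom1 p).
  by rewrite fc; apply: linv_local_diff; exact: chart_codom_center.
have fE x : ltrans_dom p 1%g p x -> 'd f x (local_field A (linv v) 1%g x)
    = (local_field A (linv v) p \o f) x.
  move=> fx /=; have x1 : chart_codom A 1%g x by case: fx.
  rewrite !local_field_linv //; last by apply: chart_codomP; case: fx.
  rewrite param_ltrans //; set q := param A 1%g x.
  have q1 : chart_dom A 1%g q by exact: param_dom.
  have qE : ltrans q 1%g 1%g c = x by rewrite ltrans_center mulg1 paramK.
  have pqp : ltrans_dom (p * q)%g 1%g p c by apply: linv_dom; case: fx.
  by have := diff_ltrans_comp v (linv_dom q1) pqp; rewrite qE.
have [_ h1E] := open_eq_is_diff (ltrans_dom_open p 1%g p) (linv_dom1 p) fE h1.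
have [_ h2E] := h2.
exact: (congr1 (fun h : V -> V => h u) (etrans (esym h2E) h1E)).
Qed.

(** In the difference of the two derivatives the second derivative of the translation cancels by
    [schwarz]; what remains is the translate of the bracket at the unit. *)
Lemma bracket_linv u v : has_coordinates V ->
  bracket A (linv u) (linv v) = linv (lie_bracket u v).
Proof.
move=> HV; rewrite funeqE => p.
have bE q : bracket A (linv u) (linv v) q =
    'd (ltrans q 1%g q) (chart A 1%g 1%g)
      ('d (local_field A (linv v) 1%g) (chart A 1%g 1%g) u
       - 'd (local_field A (linv u) 1%g) (chart A 1%g 1%g) v).
  rewrite /bracket !diff_local_field_linv // linearB /=.
  rewrite (schwarz _ _ HV (ltrans_dom_open q 1%g q) (@ltrans_smooth q 1%g q)
    (linv_dom1 q)).
  by rewrite opprD addrACA subrr add0r.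
rewrite bE /lie_bracket bE {3}/linv diff_ltrans1 //.
exact: chart_codom_center.
Qed.

End LieGroups.

(** * Complex bilinearity of the bracket *)

Section ComplexLieGroups.
Context {R : realType} {m : nat} {N : groupTopType}.
Local Notation V := (@Cspace R m).
Context (A : atlas V N) (HN : complex_lie_group A).

Let HA : lie_group A := clg_lie_group HN.

Lemma mulI_linear : linear (@mulI R m).
Proof. by move=> a u v; congr (_, _); rewrite /= scalerN opprD. Qed.

HB.instance Definition _ :=
  GRing.isLinear.Build R V V *:%R (@mulI R m) mulI_linear.

Lemma mulIK (u : V) : mulI (mulI u) = - u.
Proof. by []. Qed.

Lemma mulI_continuous : continuous (@mulI R m).
Proof.
move=> [a b].
have fc : {for (a, b), continuous (fst : V -> 'rV[R]_m)} by exact: cvg_fst.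
have sc : {for (a, b), continuous (snd : V -> 'rV[R]_m)} by exact: cvg_snd.
have nc : {for (a, b), continuous (fun u : V => - u.2)}.
  apply: (@continuous_comp _ _ _ (snd : V -> 'rV[R]_m) -%R _ sc).
  exact: opp_continuous.
exact: (@cvg_pair _ _ _ (nbhs ((a, b) : V)) (nbhs (- b)) (nbhs a) _ _ _
  (fun u : V => - u.2) fst nc fc).
Qed.

Lemma is_diff_mulI (u : V) : is_diff u (@mulI R m) (@mulI R m).
Proof. exact: is_diff_linear mulI_continuous. Qed.

(** The Cauchy-Riemann equation of the multiplication in the direction [(0, v)]. *)
Lemma local_field_linvI v q y : chart_codom A q y ->
  local_field A (linv A (mulI v)) q y = mulI (local_field A (linv A v) q y).
Proof.
move=> qy; rewrite !local_field_linvE //.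
have [_ H] := clg_mul HN q 1%g q.
rewrite -(H _ (mul_local_dom_slice qy) (0, v)).
by congr ('d _ _ _); congr (_, _); congr (_, _); rewrite oppr0.
Qed.

Lemma diff_local_field_linvI_l u v (c := chart A 1%g 1%g) :
  'd (local_field A (linv A (mulI u)) 1%g) c v
  = mulI ('d (local_field A (linv A u) 1%g) c v).
Proof.
have c1 : chart_codom A 1%g c by exact: chart_codom_center.
have := is_diff_comp (linv_local_diff HA u c1) (is_diff_mulI _).
move=> /(open_eq_is_diff (g := local_field A (linv A (mulI u)) 1%g)
  (chart_codom_open A 1%g) c1) [].
  by move=> y y1; rewrite local_field_linvI.
by move=> _ dE; exact: (congr1 (fun h : V -> V => h v) dE).
Qed.

(* The derivative of [linv v] along [w] is a mixed second derivative of the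
   multiplication; by symmetry it is the derivative, along [v] in the second
   factor, of a quantity which is complex linear in [w]. *)
Lemma diff_local_field_linvI_r u v (c := chart A 1%g 1%g) :
  'd (local_field A (linv A v) 1%g) c (mulI u)
  = mulI ('d (local_field A (linv A v) 1%g) c u).
Proof.
pose M := mul_local A 1%g 1%g 1%g.
have c1 : chart_codom A 1%g c by exact: chart_codom_center.
have Mc := mul_local_dom_slice c1.
have oM : open (mul_local_dom A 1%g 1%g 1%g) by exact: mul_local_dom_open.
have Ms : smooth_on (mul_local_dom A 1%g 1%g 1%g) M by exact: lie_mul_smooth.
have [_ MI] := clg_mul HN 1%g 1%g 1%g.
have lE w : 'd (local_field A (linv A v) 1%g) c w
    = 'd (fun z => 'd M z (w, 0)) (c, c) (0, v).
  rewrite -(schwarz (0, v) (w, 0) (has_coordinates_Cspace _) oM Ms Mc).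
  have := is_diff_comp (is_diff_pair_cstr c c)
    (smooth_on_diff (smooth_on_derive (0, v) Ms) Mc).
  move=> /(open_eq_is_diff (g := local_field A (linv A v) 1%g)
    (chart_codom_open A 1%g) c1) [].
    by move=> y y1; rewrite local_field_linvE.
  by move=> _ dE; exact: (congr1 (fun h : V -> V => h w) dE).
rewrite !lE.
have := is_diff_comp (smooth_on_diff (smooth_on_derive (u, 0) Ms) Mc)
  (is_diff_mulI _).
move=> /(open_eq_is_diff (g := fun z => 'd M z (mulI u, 0)) oM Mc) [].
  move=> z Mz; rewrite /= -(MI _ Mz (u, 0)).
  by congr ('d _ _ _); congr (_, _); congr (_, _); rewrite oppr0.
by move=> _ dE; exact: (congr1 (fun h : V * V -> V => h (0, v)) dE).
Qed.

(** Of the two derivatives in the bracket, [u] is the direction of differentiation in one and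
    generates the differentiated field in the other; both dependences commute with [mulI]. *)
Lemma lie_bracketI u v :
  lie_bracket A (mulI u) v = mulI (lie_bracket A u v).
Proof.
have mulIB (x y : V) : mulI (x - y) = mulI x - mulI y by exact: linearB.
rewrite /lie_bracket /bracket (linv1 A (mulI u)) (linv1 A u) (linv1 A v).
exact: etrans (congr2 (fun x y : V => x - y) (diff_local_field_linvI_r u v)
  (diff_local_field_linvI_l u v)) (esym (mulIB _ _)).
Qed.

End ComplexLieGroups.

(** * Orthonormal frames and projections *)

Section InnerProduct.
Context {R : rcfType} {V : vectType R} (ip : V -> V -> R).
Context (ip_sym : forall u v, ip u v = ip v u).
Context (ip_linear : forall v, linear (ip ^~ v : V -> R^o)).
Context (ip_pos : forall u, u != 0 -> 0 < ip u u).

Let ipP a u v w : ip (a *: u + v) w = a * ip u w + ip v w.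
Proof. exact: ip_linear. Qed.

Let ip0 w : ip 0 w = 0.
Proof. by have := ipP (-1) 0 0 w; rewrite scaler0 addr0 mulN1r addNr. Qed.

Let ipD u v w : ip (u + v) w = ip u w + ip v w.
Proof. by rewrite -[u]scale1r ipP mul1r scale1r. Qed.

Let ipZ a u w : ip (a *: u) w = a * ip u w.
Proof. by rewrite -[a *: u]addr0 ipP ip0 addr0. Qed.

Let ip_sum (I : Type) (r : seq I) (F : I -> V) w :
  ip (\sum_(i <- r) F i) w = \sum_(i <- r) ip (F i) w.
Proof. exact: (big_morph (ip ^~ w) (fun u v => ipD u v w) (ip0 w)). Qed.

Definition orthonormal_seq (s : seq V) :=
  uniq s /\ {in s &, forall x y, ip x y = (x == y)%:R}.

Definition proj_seq (s : seq V) (v : V) := \sum_(x <- s) ip v x *: x.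

Lemma proj_seq_linear s : linear (proj_seq s).
Proof.
move=> a u v; rewrite /proj_seq scaler_sumr -big_split.
by apply: eq_bigr => x _; rewrite ipP scalerDl scalerA.
Qed.

Lemma ip_proj_seq s v y : orthonormal_seq s -> y \in s ->
  ip (proj_seq s v) y = ip v y.
Proof.
move=> [us os] ys; rewrite ip_sum (bigD1_seq y) //= big_seq_cond big1 => [|x].
  by rewrite ipZ (os y y) // eqxx mulr1 addr0.
by case/andP=> xs xy; rewrite ipZ (os x y) // (negbTE xy) mulr0.
Qed.

(** Pairing a vanishing combination with a member of [s] isolates its coefficient, so [s] is free.
    The bound makes a sequence of maximal length available below. *)
Lemma orthonormal_seq_size s : orthonormal_seq s -> (size s <= \dim {:V})%N.
Proof.
move=> [us os]; suff fs : free s.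
  by move: fs; rewrite /free => /eqP <-; apply/dimvS/subvf.
have -> : s = in_tuple s by [].
apply/freeP => k ks i.
have : ip (\sum_(j < size s) k j *: (in_tuple s)`_j) (in_tuple s)`_i = 0.
  by rewrite ks ip0.
rewrite ip_sum (bigD1 i) //= big1 => [|j ji].
  by rewrite ipZ os ?mem_nth // eqxx mulr1 addr0.
by rewrite ipZ os ?mem_nth // nth_uniq // (inj_eq val_inj) (negbTE ji) mulr0.
Qed.

(** An orthonormal sequence in [S] of maximal length works: if some [v] in [S] differed from its
    projection, the normalised difference would extend the sequence. *)
Lemma orthonormal_seq_exists (S : V -> Prop) :
  S 0 -> (forall a u v, S u -> S v -> S (a *: u + v)) ->
  exists s, [/\ orthonormal_seq s, forall x, x \in s -> S x &
    forall v, S v -> v = proj_seq s v].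
Proof.
move=> S0 SD.
pose Q n := exists s,
  [/\ orthonormal_seq s, forall x, x \in s -> S x & size s = n].
have Q0 : exists n, `[< Q n >] by exists 0%N; apply/asboolP; exists [::].
have Qle n : `[< Q n >] -> (n <= \dim {:V})%N.
  by move=> /asboolP [s [os _ <-]]; exact: orthonormal_seq_size.
case: (ex_maxnP Q0 Qle) => n /asboolP [s [os sS sn]] nmax.
exists s; split=> // v Sv; apply/eqP; rewrite -subr_eq0; apply/negPn/negP => r0.
set r := v - proj_seq s v in r0.
have Sp : S (proj_seq s v).
  rewrite /proj_seq; elim: (s) sS => [|x s' IH] sS; first by rewrite big_nil.
  rewrite big_cons; apply: SD; first by apply: sS; rewrite inE eqxx.
  by apply: IH => y ys; apply: sS; rewrite inE ys orbT.
have Sr : S r by rewrite /r addrC -scaleN1r; exact: SD.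
have rs y : y \in s -> ip r y = 0.
  move=> ys; rewrite /r addrC -scaleN1r ipP (ip_proj_seq _ os ys).
  by rewrite mulN1r addNr.
pose x := (Num.sqrt (ip r r))^-1 *: r.
have sr0 : 0 < Num.sqrt (ip r r) by rewrite sqrtr_gt0 ip_pos.
have xx : ip x x = 1.
  rewrite ipZ ip_sym ipZ mulrA -invfM -expr2 sqr_sqrtr ?mulVf //.
    by rewrite gt_eqF // ip_pos.
  by rewrite ltW // ip_pos.
have xs y : y \in s -> ip x y = 0 by move=> ys; rewrite ipZ (rs y ys) mulr0.
have xNs : x \notin s.
  by apply/negP => /xs; rewrite xx => /eqP; rewrite oner_eq0.
have : `[< Q n.+1 >].
  apply/asboolP; exists (x :: s); split; last by rewrite /= sn.
  - split; first by rewrite /= xNs; case: os.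
    move=> y z; rewrite !inE => /orP[/eqP->|ys] /orP[/eqP->|zs].
    + by rewrite xx eqxx.
    + by rewrite xs //; case: eqVneq zs xNs => // <- ->.
    + by rewrite ip_sym xs //; case: eqVneq ys xNs => // -> ->.
    + by case: os => _ ->.
  - move=> y; rewrite inE => /orP[/eqP->|]; last exact: sS.
    by rewrite /x -[_ *: r]addr0; exact: SD.
by move=> /nmax; rewrite ltnn.
Qed.

Lemma orthogonal_projection (S : V -> Prop) :
  S 0 -> (forall a u v, S u -> S v -> S (a *: u + v)) ->
  exists P : V -> V, [/\ linear P, forall v, S (P v) &
    forall v w, S w -> ip (P v) w = ip v w].
Proof.
move=> S0 SD; have [s [os sS sE]] := orthonormal_seq_exists S0 SD.
exists (proj_seq s); split; first exact: proj_seq_linear.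
  move=> v; rewrite /proj_seq; elim: (s) sS => [|x s' IH] sS.
    by rewrite big_nil.
  rewrite big_cons; apply: SD; first by apply: sS; rewrite inE eqxx.
  by apply: IH => y ys; apply: sS; rewrite inE ys orbT.
(* Expanding [w] along [s] leaves only pairings with members of [s], which the projection
   preserves. *)
move=> v w Sw; rewrite (sE _ Sw) ![ip _ (proj_seq s w)]ip_sym !ip_sum.
rewrite big_seq [RHS]big_seq; apply: eq_bigr => x xs.
by rewrite !ipZ ![ip x _]ip_sym ip_proj_seq.
Qed.

End InnerProduct.

(** * Left invariant metrics *)

Section LeftInvariantMetrics.
Context {R : realType} {V : normedModType R} {N : groupTopType}.
Context (A : atlas V N) (HA : lie_group A) (g : N -> V -> V -> R).
Context (Hg : riemannian_metric A g) (Hleft : left_invariant_metric A g).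

Lemma smooth_field_comb f X Y : smooth_fun A f -> smooth_field A X ->
  smooth_field A Y -> smooth_field A (fun p => f p *: X p + Y p).
Proof.
move=> fs Xs Ys q; apply: (smooth_on_eq (f := fun y =>
  (f \o param A q) y *: local_field A X q y + local_field A Y q y)).
- exact: chart_codom_open.
- by move=> y _; rewrite !local_fieldE linearP.
have oq := chart_codom_open A q.
by apply: smooth_onD => //; apply: smooth_on_scale => //; exact: fs.
Qed.

Lemma metricP p a u v w : g p (a *: u + v) w = a * g p u w + g p v w.
Proof. exact: (metric_linear Hg p a u v w). Qed.

Lemma metric0 p w : g p 0 w = 0.
Proof. by have := metricP p (-1) 0 0 w; rewrite scaler0 addr0 mulN1r addNr. Qed.

Lemma metricD p u v w : g p (u + v) w = g p u w + g p v w.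
Proof. by rewrite -[u]scale1r metricP mul1r scale1r. Qed.

Lemma metricB p u v w : g p (u - v) w = g p u w - g p v w.
Proof. by rewrite addrC -scaleN1r metricP mulN1r addrC. Qed.

Lemma metric_nondegenerate p u : (forall w, g p u w = 0) -> u = 0.
Proof.
move=> u0; apply/eqP/negPn/negP => /(metric_posdef Hg p).
by rewrite u0 ltxx.
Qed.

(** Left invariant fields have constant inner products: both vectors are translated from the
    unit. *)
Lemma metric_linv p u v : g p (linv A u p) (linv A v p) = g 1%g u v.
Proof.
have := Hleft p 1%g (linv A u 1%g) (linv A v 1%g).
by rewrite !(tangent_map_linv HA) mulg1 !linv1.
Qed.

Lemma linv0 : linv A 0 = fun _ => 0.
Proof. by rewrite funeqE => p; rewrite /linv linear0. Qed.

(** * Left invariant orthonormal frames and endomorphism fields *)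

Section Frame.
Context (s : seq V) (sE : forall v, v = \sum_(x <- s) g 1%g v x *: x).

(* The left invariant endomorphism field with value [S] at [1], written in the
   left invariant frame [s] so that its smoothness is visible. *)
Definition extend (S : V -> V) (p : N) (u : V) : V :=
  \sum_(x <- s) g p u (linv A x p) *: linv A (S x) p.

Lemma extend_linear S p : linear (extend S p).
Proof.
move=> a u v; rewrite /extend scaler_sumr -big_split.
by apply: eq_bigr => x _; rewrite metricP scalerDl scalerA.
Qed.

(** By [metric_linv] the coefficients of [linv A v p] in the frame are those of [v] at the unit. *)
Lemma extend_linv S p v : linear S ->
  extend S p (linv A v p) = linv A (S v) p.
Proof.
move=> S_linear.
pose SL : {linear V -> V} :=
  HB.pack S (GRing.isLinear.Build _ _ _ _ S S_linear).
rewrite {2}(sE v) -[S _]/(SL _) /linv !linear_sum; apply: eq_bigr => x _.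
by rewrite !linearZ /= metric_linv.
Qed.

Lemma frame_decomposition u p :
  u = \sum_(x <- s) g p u (linv A x p) *: linv A x p.
Proof.
have [v ->] := linv_surj HA p u.
by rewrite -[RHS]/(extend id p _) extend_linv.
Qed.

(** A smooth field is a combination of left invariant ones with smooth functions as coefficients.
    This reduces tensorial statements to left invariant fields. *)
Lemma frame_ind (Q : (N -> V) -> Prop) :
  (forall v, Q (linv A v)) ->
  (forall f X Y, smooth_fun A f -> smooth_field A X -> smooth_field A Y ->
     Q X -> Q Y -> Q (fun p => f p *: X p + Y p)) ->
  forall X, smooth_field A X -> Q X.
Proof.
move=> Ql Qc X Xs.
have -> : X = fun p => \sum_(x <- s) g p (X p) (linv A x p) *: linv A x p.
  by rewrite funeqE => p; exact: frame_decomposition.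
(* Smoothness of the partial sums is proved along with [Q], because the closure hypothesis on [Q]
   asks for smooth summands. *)
suff [] : smooth_field A
    (fun p => \sum_(x <- s) g p (X p) (linv A x p) *: linv A x p) /\
  Q (fun p => \sum_(x <- s) g p (X p) (linv A x p) *: linv A x p) by [].
elim: (s) => [|x s' [IHs IHQ]].
  rewrite (_ : (fun p => _) = linv A 0); last first.
    by rewrite linv0 funeqE => p; rewrite big_nil.
  by split=> //; exact: linv_smooth.
rewrite (_ : (fun p => _) = fun p => g p (X p) (linv A x p) *: linv A x p +
    \sum_(y <- s') g p (X p) (linv A y p) *: linv A y p); last first.
  by rewrite funeqE => p; rewrite big_cons.
have xs : smooth_field A (linv A x) by exact: linv_smooth.
have fs : smooth_fun A (fun p => g p (X p) (linv A x p)).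
  exact: metric_smooth.
by split; [exact: smooth_field_comb|exact: Qc].
Qed.

Lemma extend_endomorphism S : linear S -> endomorphism_field A (extend S).
Proof.
move=> S_linear; split; first exact: extend_linear.
apply: frame_ind => [v|f X Y fs Xs Ys SX SY].
  rewrite (_ : (fun p => _) = linv A (S v)); first exact: linv_smooth.
  by rewrite funeqE => p; exact: extend_linv.
rewrite (_ : (fun p => _) =
    fun p => f p *: extend S p (X p) + extend S p (Y p)).
  exact: smooth_field_comb.
by rewrite funeqE => p; exact: extend_linear.
Qed.

Lemma extend_bijective S S' : linear S -> linear S' ->
  cancel S S' -> cancel S' S -> invertible_endo (extend S).
Proof.
move=> Sl Sl' SK SK' p; exists (extend S' p) => u;
  have [v ->] := linv_surj HA p u.
  by rewrite !extend_linv // SK.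
by rewrite !extend_linv // SK'.
Qed.

End Frame.

(** * The Levi-Civita connection on left invariant fields, and tensoriality *)

Section Connection.
Context (nabla : (N -> V) -> (N -> V) -> N -> V).
Context (Hnabla : levi_civita A g nabla).

(** The inner product of two left invariant fields is constant, so its derivative in the metric
    compatibility vanishes. *)
Lemma nabla_linv_metric u v w p :
  g p (nabla (linv A u) (linv A v) p) (linv A w p)
  = - g p (nabla (linv A u) (linv A w) p) (linv A v p).
Proof.
have := lc_metric Hnabla (linv_smooth HA u) (linv_smooth HA v)
  (linv_smooth HA w) p.
have -> : (fun x => g x (linv A v x) (linv A w x)) = fun _ => g 1%g v w.
  by rewrite funeqE => x; exact: metric_linv.
rewrite /dirder (_ : _ \o _ = cst (g 1%g v w : R^o)) // diff_cst /= => /esym.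
rewrite [X in _ + X](Defs.metric_sym Hg) => /eqP.
by rewrite addr_eq0 => /eqP.
Qed.

Lemma nabla_linv_torsion u v w p : has_coordinates V ->
  g p (nabla (linv A u) (linv A v) p) (linv A w p)
  - g p (nabla (linv A v) (linv A u) p) (linv A w p)
  = g 1%g (lie_bracket A u v) w.
Proof.
move=> HV; rewrite -metricB.
rewrite (lc_torsion_free Hnabla (linv_smooth HA u) (linv_smooth HA v)).
by rewrite bracket_linv // metric_linv.
Qed.

Context (T : N -> V -> V) (HT : endomorphism_field A T).

Lemma nabla_endo_combl f X X' Y p : smooth_fun A f ->
  smooth_field A X -> smooth_field A X' -> smooth_field A Y ->
  nabla_endo nabla T (fun x => f x *: X x + X' x) Y p
  = f p *: nabla_endo nabla T X Y p + nabla_endo nabla T X' Y p.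
Proof.
move=> fs Xs Xs' Ys; rewrite /nabla_endo !(lc_linearl Hnabla) //; last first.
  exact: endo_smooth.
by rewrite (endo_linear HT) scalerBr opprD addrACA.
Qed.

Lemma nabla_endo_combr f X Y Y' p : smooth_fun A f ->
  smooth_field A X -> smooth_field A Y -> smooth_field A Y' ->
  nabla_endo nabla T X (fun x => f x *: Y x + Y' x) p
  = f p *: nabla_endo nabla T X Y p + nabla_endo nabla T X Y' p.
Proof.
move=> fs Xs Ys Ys'; rewrite /nabla_endo.
have T_linear x a u v : T x (a *: u + v) = a *: T x u + T x v.
  exact: (endo_linear HT x a u v).
have zs : smooth_field A (fun _ => 0).
  by rewrite -linv0; exact: linv_smooth.
have fYs : smooth_field A (fun x => f x *: Y x).
  rewrite (_ : (fun x => _) = fun x => f x *: Y x + 0).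
    exact: smooth_field_comb.
  by rewrite funeqE => x; rewrite addr0.
have fTYs : smooth_field A (fun x => f x *: T x (Y x)).
  rewrite (_ : (fun x => _) = fun x => f x *: T x (Y x) + 0).
    by apply: smooth_field_comb => //; exact: endo_smooth.
  by rewrite funeqE => x; rewrite addr0.
rewrite (_ : (fun x => T x _) = fun x => f x *: T x (Y x) + T x (Y' x));
  last by rewrite funeqE => x; exact: T_linear.
have TYs := endo_smooth HT Ys; have TYs' := endo_smooth HT Ys'.
rewrite !(lc_additiver Hnabla) // !(lc_leibniz Hnabla) //.
(* Here [a] is the Leibniz term, the derivative of [f] times [T] of [Y]; it occurs in both halves of
   [nabla_endo], and its cancellation is the tensoriality in the second field. *)
have cancel (a b c d e : V) : a + b + c - (a + (d + e)) = b - d + (c - e).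
  by rewrite -[a + b + c]addrA opprD addrACA subrr add0r opprD addrACA.
by rewrite -[X in _ - T p X = _]addrA !T_linear cancel scalerBr.
Qed.

End Connection.

End LeftInvariantMetrics.

(** * The Killing-Yano endomorphism at the identity *)

Section HermitianAlgebra.
Context {R : realFieldType} {V : lmodType R} (ip : V -> V -> R).
Context (ip_sym : forall u v, ip u v = ip v u).
Context (ip_linear : forall a u v w, ip (a *: u + v) w = a * ip u w + ip v w).
Context (ip_pos : forall u, u != 0 -> 0 < ip u u).
Context (J : {linear V -> V}) (JK : forall u, J (J u) = - u).
Context (J_isometry : forall u v, ip (J u) (J v) = ip u v).
Context (S : V -> Prop) (SJ : forall u, S u -> S (J u)).
Context (SD : forall a u v, S u -> S v -> S (a *: u + v)).
Context (P : {linear V -> V}) (SP : forall v, S (P v)).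
Context (ip_P : forall v w, S w -> ip (P v) w = ip v w).

Let ip0 w : ip 0 w = 0.
Proof.
by have := ip_linear (-1) 0 0 w; rewrite scaler0 addr0 mulN1r addNr.
Qed.

Let ipN u w : ip (- u) w = - ip u w.
Proof. by rewrite -scaleN1r -[_ *: _]addr0 ip_linear ip0 addr0 mulN1r. Qed.

Let ip_linear_r a u v w : ip w (a *: u + v) = a * ip w u + ip w v.
Proof. by rewrite ip_sym ip_linear ![ip _ w]ip_sym. Qed.

(** The difference of [x] and [P v] lies in [S] and is orthogonal to [S], hence to itself. *)
Lemma proj_unique x v : S x -> (forall w, S w -> ip x w = ip v w) -> x = P v.
Proof.
move=> Sx xv; apply/eqP; rewrite -subr_eq0; apply/negPn/negP => /ip_pos.
rewrite addrC -scaleN1r ip_linear ip_P ?xv ?mulN1r ?addNr ?ltxx //.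
  exact: SD.
exact: SD.
Qed.

Lemma proj_id w : S w -> P w = w.
Proof. by move=> Sw; rewrite -(proj_unique Sw). Qed.

Lemma proj_sym u v : ip (P u) v = ip u (P v).
Proof. by rewrite -(ip_P u (SP v)) [LHS]ip_sym -ip_P // ip_sym. Qed.

Lemma J_skew u v : ip (J u) v = - ip u (J v).
Proof. by rewrite -J_isometry JK ipN. Qed.

(** As [J] is skew and preserves [S], the vector [J (P v)] lies in [S] and has the same pairings
    with [S] as [J v]. *)
Lemma projJ v : P (J v) = J (P v).
Proof.
symmetry; apply: proj_unique => [|w Sw]; first exact/SJ/SP.
by rewrite !J_skew ip_P //; exact: SJ.
Qed.

(* [ky_map] is [3 J] on [S] and [J] on the orthogonal complement of [S]. *)
Definition ky_map u := J (2 *: P u + u).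

Lemma ky_map_linear : linear ky_map.
Proof.
move=> a u v; rewrite /ky_map -[RHS]linearP; congr (J _).
rewrite linearP /= !scalerDr addrACA; congr (_ + _).
by congr (_ + _); rewrite !scalerA mulrC.
Qed.

Lemma ky_map_skew u v : ip (ky_map u) v = - ip u (ky_map v).
Proof.
rewrite /ky_map J_skew ip_linear proj_sym projJ.
by rewrite linearP /= ip_linear_r.
Qed.

(** [P] is self-adjoint, commutes with [J] and fixes [u], so it drops out of the pairing and the
    coefficients 2 and 1 add up. *)
Lemma ip_ky_map u v : S u -> ip u (ky_map v) = 3 * ip u (J v).
Proof.
move=> Su; rewrite /ky_map linearP /= ip_linear_r -projJ -proj_sym proj_id //.
by ring.
Qed.

(** This is [- J / 3] on [S] and [- J] on its orthogonal complement. *)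
Definition ky_map_inv u := (2 / 3) *: P (J u) - J u.

Lemma ky_map_inv_linear : linear ky_map_inv.
Proof.
move=> a u v; rewrite /ky_map_inv (linearP J) (linearP P) /=.
rewrite scalerDr opprD addrACA.
by rewrite scalerBr !scalerA [2 / 3 * a]mulrC.
Qed.

Lemma ky_mapK : cancel ky_map ky_map_inv.
Proof.
move=> u; rewrite /ky_map /ky_map_inv JK opprK linearN linearP /=.
rewrite (proj_id (SP u)) scalerN.
have -> : (2 / 3) *: (2 *: P u + P u) = 2 *: P u.
  by rewrite -[X in _ + X]scale1r -scalerDl scalerA; congr (_ *: _); field.
by rewrite addrA addNr add0r.
Qed.

Lemma ky_map_invK : cancel ky_map_inv ky_map.
Proof.
move=> u; rewrite /ky_map /ky_map_inv [P (_ - _)]linearB [P (_ *: _)]linearZ /=.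
rewrite (proj_id (SP (J u))).
have -> : 2 *: ((2 / 3) *: P (J u) - P (J u)) = - ((2 / 3) *: P (J u)).
  rewrite -[X in _ - X]scale1r -scalerBl scalerA -scaleNr; congr (_ *: _).
  by field.
by rewrite addrA addNr add0r linearN JK opprK.
Qed.

End HermitianAlgebra.

(* With the notation of the header, [al u v w] is the inner product of nabla_u v
   and w, and [c u v w] that of the bracket of u, v and w. *)
Lemma ky_koszul (R : realFieldType) (V : Type) (T : V -> V)
    (al c k : V -> V -> V -> R) :
  (forall u v w, al u v w = - al u w v) ->
  (forall u v w, al u v w - al v u w = c u v w) ->
  (forall u v w, c u v w = - c v u w) ->
  (forall u v w, c (T u) v w = - k u v w) ->
  (forall u v w, c u v (T w) = 3 * k u v w) ->
  forall u v w,
    al u (T v) w + al u v (T w) = k u v w + k v w u + k w u v.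
Proof.
move=> al_skew al_c c_alt cT c_T u v w.
(* Koszul's formula without derivative terms, as inner products of left invariant fields are
   constant. *)
have koszul x y z : 2 * al x y z = c x y z - c y z x + c z x y.
  rewrite -!al_c.
  have := al_skew x z y; have := al_skew z y x; have := al_skew y z x; lra.
have k_alt x y z : k x y z = - k y x z.
  by have := c_alt x y (T z); rewrite !c_T; lra.
(* The term [k u v w] collects the coefficients -1 and 3, [k v w u] collects 1 and 1, and [k w u v]
   collects 3 and -1. Each total is 2; this balance is what the factor 3 is for. *)
have := koszul u (T v) w; have := koszul u v (T w).
rewrite !c_T (c_alt v) (c_alt u (T v)) !cT (k_alt v u) (k_alt w v).
lra.
Qed.

Lemma lie_bracket_alt (R : realType) (V : normedModType R) (N : groupTopType)
  (A : atlas V N) u v : lie_bracket A u v = - lie_bracket A v u.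
Proof. by rewrite /lie_bracket /bracket opprB. Qed.

(** The local expression of [linv A v] is linear in [v], and so is its differential. *)
Lemma lie_bracket_linear (R : realType) (V : normedModType R)
    (N : groupTopType) (A : atlas V N) (HA : lie_group A) w :
  linear (lie_bracket A ^~ w).
Proof.
move=> a u v; rewrite /lie_bracket /bracket !linv1 linearP.
set c := chart A 1%g 1%g.
have c1 : chart_codom A 1%g c by exact: chart_codom_center.
have uv := is_diff_add (is_diffZ a (linv_local_diff HA u c1))
  (linv_local_diff HA v c1).
have lE y : chart_codom A 1%g y ->
    (a *: local_field A (linv A u) 1%g) y + local_field A (linv A v) 1%g y
    = local_field A (linv A (a *: u + v)) 1%g y.
  by move=> _; rewrite fctE !local_fieldE linv_linear linearP.
have [_ dE] := open_eq_is_diff (chart_codom_open A 1%g) c1 lE uv.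
have -> : 'd (local_field A (linv A (a *: u + v)) 1%g) c w
    = a *: 'd (local_field A (linv A u) 1%g) c w
      + 'd (local_field A (linv A v) 1%g) c w.
  exact: (congr1 (fun h => h w) dE).
by rewrite scalerBr opprD addrACA.
Qed.

Theorem proposition3p5 (R : realType) (m : nat) (N : groupTopType)
    (A : atlas (@Cspace R m) N) (HN : complex_lie_group A)
    (H2 : two_step_nilpotent A)
    (g : N -> @Cspace R m -> @Cspace R m -> R)
    (Hg : riemannian_metric A g) (Hleft : left_invariant_metric A g)
    (Hherm : hermitian_metric g)
    (nabla : (N -> @Cspace R m) -> (N -> @Cspace R m) -> N -> @Cspace R m)
    (Hnabla : levi_civita A g nabla) :
  exists T : N -> @Cspace R m -> @Cspace R m,
    [/\ killing_yano A g nabla T,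
        ~ parallel_endo A nabla T &
        invertible_endo T].
Proof.
have HA : lie_group A := clg_lie_group HN.
have HV : has_coordinates (@Cspace R m) := has_coordinates_Cspace m.
pose V := @Cspace R m.
pose ip : V -> V -> R := g 1%g.
pose br : V -> V -> V := lie_bracket A.
have ip_sym u v : ip u v = ip v u := Defs.metric_sym Hg 1%g u v.
have ip_linear a u v w : ip (a *: u + v) w = a * ip u w + ip v w.
  exact: (metricP Hg 1%g a u v w).
have ip0 w : ip 0 w = 0 by exact: (metric0 Hg 1%g w).
have ipN u w : ip (- u) w = - ip u w.
  by rewrite -scaleN1r -[_ *: _]addr0 ip_linear ip0 addr0 mulN1r.
have ip_pos u : u != 0 -> 0 < ip u u := @metric_posdef _ _ _ _ _ Hg 1%g u.
have J_isometry u v : ip (mulI u) (mulI v) = ip u v := Hherm 1%g u v.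
have brlP a u v w : br (a *: u + v) w = a *: br u w + br v w.
  exact: (lie_bracket_linear HA w a u v).
have br0 w : br 0 w = 0.
  by have := brlP (-1) 0 0 w; rewrite scaler0 addr0 scaleN1r addNr.
have brN u w : br (- u) w = - br u w.
  by rewrite -(scaleN1r u) -[X in br X]addr0 brlP br0 addr0 scaleN1r.
have br_alt u v : br u v = - br v u by exact: lie_bracket_alt.
have brJ u v : br (mulI u) v = mulI (br u v) by exact: (lie_bracketI HN).
pose center u := forall v, br u v = 0.
have center0 : center 0 by [].
have centerD a u v : center u -> center v -> center (a *: u + v).
  by move=> uc vc w; rewrite brlP uc vc scaler0 addr0.
have centerJ u : center u -> center (mulI u).
  by move=> uc w; rewrite brJ uc linear0.
(* [bracket_linv] makes the inner bracket a left invariant field again, so that nilpotency at the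
   unit becomes a statement about [br]. *)
have center_br u v : center (br u v).
  move=> w; have [_ /(_ _ _ _ (linv_lie_algebra HA u) (linv_lie_algebra HA v)
    (linv_lie_algebra HA w) 1%g)] := H2.
  by rewrite (bracket_linv HA).
have [s [_ _ sE]] := @orthonormal_seq_exists R ('rV[R]_m * 'rV[R]_m)%type ip
  ip_sym (fun w a u v => ip_linear a u v w) ip_pos (fun=> True) I
  (fun _ _ _ _ _ => I).
have {}sE (v : V) : v = \sum_(x <- s) g 1%g v x *: x by exact: sE.
have [P0 [P0_linear SP ip_P]] :=
  @orthogonal_projection R ('rV[R]_m * 'rV[R]_m)%type ip
  ip_sym (fun w a u v => ip_linear a u v w) ip_pos center center0 centerD.
pose P : {linear V -> V} :=
  HB.pack (P0 : V -> V) (GRing.isLinear.Build _ _ _ _ (P0 : V -> V) P0_linear).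
pose J : {linear V -> V} := (@mulI R m : {linear V -> V}).
pose S := ky_map J P.
have S_linear : linear S by exact: ky_map_linear.
have S_skew u v : ip (S u) v = - ip u (S v).
  exact: (ky_map_skew ip_sym ip_linear ip_pos (J := J) (@mulIK R m) J_isometry
    centerJ centerD (P := P) SP ip_P).
have SK : cancel S (ky_map_inv J P).
  exact: (ky_mapK ip_linear ip_pos (J := J) (@mulIK R m) centerD
    (P := P) SP ip_P).
have SK' : cancel (ky_map_inv J P) S.
  exact: (ky_map_invK ip_linear ip_pos (J := J) (@mulIK R m) centerD
    (P := P) SP ip_P).
pose T := extend A g s S.
have T_linv v p : T p (linv A v p) = linv A (S v) p.
  exact: (extend_linv HA Hleft sE p v S_linear).
have T_endo : endomorphism_field A T.
  exact: (extend_endomorphism HA Hg Hleft sE S_linear).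
have T_skew p u v : g p (T p u) v = - g p u (T p v).
  have [u' ->] := linv_surj HA p u; have [v' ->] := linv_surj HA p v.
  by rewrite !T_linv !(metric_linv HA Hleft); exact: S_skew.
pose k u v w := ip (br u v) (mulI w).
have nablaT u v w p :
    g p (nabla_endo nabla T (linv A u) (linv A v) p) (linv A w p)
    = k u v w + k v w u + k w u v.
  rewrite /nabla_endo.
  have -> : (fun x => T x (linv A v x)) = linv A (S v).
    by rewrite funeqE => x; exact: T_linv.
  (* Skewness moves [T] onto [w], which gives the left-hand side of [ky_koszul]. *)
  rewrite (metricB Hg) T_skew opprK T_linv.
  apply: (@ky_koszul R V S (fun u v w =>
    g p (nabla (linv A u) (linv A v) p) (linv A w p))
    (fun u v w => ip (br u v) w) k).
  - by move=> *; exact: (nabla_linv_metric HA Hg Hleft Hnabla).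
  - by move=> *; exact: (nabla_linv_torsion HA Hg Hleft Hnabla _ _ _ _ HV).
  - by move=> x y z; rewrite br_alt ipN.
  (* The projected part of [x] is central and drops out of the bracket; only [J] remains, and it is
     skew. *)
  - move=> x y z; rewrite /S /ky_map brJ /= brlP (SP x) scaler0 add0r.
    exact: (J_skew ip_linear (J := J) (@mulIK R m) J_isometry).
  - move=> x y z; exact: (ip_ky_map ip_sym ip_linear ip_pos (J := J)
      (@mulIK R m) J_isometry centerJ centerD (P := P) SP ip_P z (center_br x y)).
have k_alt u v w : k u v w = - k v u w.
  by rewrite /k br_alt ipN.
have ky_linv u v p : nabla_endo nabla T (linv A u) (linv A v) p
    = - nabla_endo nabla T (linv A v) (linv A u) p.
  apply/eqP; rewrite -addr_eq0; apply/eqP.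
  apply: (metric_nondegenerate Hg (p := p)) => w.
  have [w' ->] := linv_surj HA p w.
  rewrite (metricD Hg p (nabla_endo nabla T (linv A u) (linv A v) p)).
  apply: (etrans (congr2 +%R (nablaT u v w' p) (nablaT v u w' p))).
  have := k_alt u v w'; have := k_alt v w' u; have := k_alt w' u v; lra.
have comb_opp (a : R) (x x' y y' : V) :
    x = - y -> x' = - y' -> a *: x + x' = - (a *: y + y').
  by move=> -> ->; rewrite scalerN opprD.
have ky X Y : smooth_field A X -> smooth_field A Y -> forall p,
    nabla_endo nabla T X Y p = - nabla_endo nabla T Y X p.
  (* Induction on [X] with [Y] still general, then on [Y] when [X] is left invariant. *)
  move=> Xs; move: X Xs Y; apply: (frame_ind HA Hg Hleft sE).
    move=> u; apply: (frame_ind HA Hg Hleft sE)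
      => [v|f Y Y' fs Ys Ys' IH IH'] p.
      exact: ky_linv.
    have us : smooth_field A (linv A u) by exact: linv_smooth.
    apply: (etrans (nabla_endo_combr HA Hnabla T_endo p fs us Ys Ys')).
    rewrite [X in _ = - X](nabla_endo_combl Hnabla T_endo p fs Ys Ys' us).
    exact: comb_opp (IH p) (IH' p).
  move=> f X X' fs Xs Xs' IH IH' Y Ys p.
  apply: (etrans (nabla_endo_combl Hnabla T_endo p fs Xs Xs' Ys)).
  rewrite [X in _ = - X](nabla_endo_combr HA Hnabla T_endo p fs Ys Xs Xs').
  exact: comb_opp (IH Y Ys p) (IH' Y Ys p).
exists T; split; first by split.
- move=> parallel.
  have [[X [Y [X_la Y_la [p brXY]]]] _] := H2.
  pose b := br (X 1%g) (Y 1%g).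
  (* The bracket of [X] and [Y] is the left invariant field of [b], which would vanish everywhere if
     [b] did. *)
  have b0 : b != 0.
    apply/eqP => b0; apply: brXY.
    rewrite (lie_algebraE X_la) (lie_algebraE Y_la) (bracket_linv HA) //.
    by rewrite -[lie_bracket A _ _]/b b0 linv0.
  (* Chosen so that [mulI w] is [b]. As [w] is central, two of the three cyclic terms vanish and the
     third is [ip b b]. *)
  pose w := - mulI b.
  have wc : center w.
    by move=> v; rewrite (brN (mulI b) v) (centerJ b (center_br _ _) v) oppr0.
  have k0 u v : k w u v = 0 by rewrite /k (wc u) ip0.
  have kb : k (X 1%g) (Y 1%g) w = ip b b.
    have mulINI (u : V) : mulI (- mulI u) = u.
      by case: u => x y; congr (_, _); exact: opprK.
    by rewrite -[LHS]/(ip b (mulI w)) /w mulINI.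
  have := nablaT (X 1%g) (Y 1%g) w p.
  rewrite (parallel _ _ (linv_smooth HA _) (linv_smooth HA _) p) (metric0 Hg).
  rewrite (k_alt (Y 1%g)) !k0 kb oppr0 !addr0 => b0'.
  by have := ip_pos b b0; rewrite -b0' ltxx.
- exact: (extend_bijective HA Hleft sE S_linear (ky_map_inv_linear _ _) SK SK').
Qed.
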